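(* Let $T\in(0,\infty]$, $n\in\mathbb{N}$, $u_0\in\mathbb{R}^n$, let $A:\mathbb{R}\to\mathbb{R}^{n\times n}$ be continuous on $(0,\infty)$, let $G$ be the solution of $$G'(t)+A(t)\,G(t)=0 \ \text{ on } (0,\infty),\qquad G(0)=\mathrm{Id},$$ and let $\ell:\mathbb{R}\to\mathbb{R}^{n\times n}$ be continuous on $(0,\infty)$. The solution $u$ of $$u'(t)+A(t)\,u(t)=-\ell(t)\,u_0\ \text{ on }(0,\infty),\qquad u(0)=u_0,$$ satisfies $u(t)=0$ for $t\ge T$ if and only if $\ell$ satisfies $$\mathrm{Id}=\int_0^T G^{-1}(s)\,\ell(s)\,ds\qquad\text{with}\qquad \ell(s)=0\ \text{ for } s>T.$$
   Context: $\mathrm{Id}$ denotes the $n\times n$ identity matrix. $G(t)\in\mathbb{R}^{n\times n}$ is the fundamental matrix of the linear system, which exists uniquely and is invertible for every $t$; $G^{-1}(s)$ denotes the inverse matrix of $G(s)$.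
   Formalization: The vanishing of u is required for every initial vector u_0 (for a fixed u_0, e.g. u_0=0, ''only if'' is false); for T=∞, ''u(t)=0 for t≥T'' is read as G^{-1}(t)u(t)→0 as t→∞, since the literal claim is false there; the integral is improper at 0 and T. *)

(* Defs.v *)
(* MathComp-Analysis *)
From HB Require Import structures.
From mathcomp Require Import all_boot all_order all_algebra.
From mathcomp Require Import all_classical all_reals all_analysis.

Set Implicit Arguments.
Unset Strict Implicit.
Unset Printing Implicit Defensive.

Import Order.TTheory GRing.Theory Num.Theory.
Import numFieldNormedType.Exports.

Local Open Scope classical_set_scope.
Local Open Scope ring_scope.

(* Coefficients may be singular at 0, so the equation is imposed on (0, oo)
   only; the right-continuity at 0 is what makes the initial value binding. *)
Definition linear_ivp (R : realType) (n m : nat)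
    (A : R -> 'M[R]_n) (b : R -> 'M[R]_(n, m)) (y0 : 'M[R]_(n, m))
    (y : R -> 'M[R]_(n, m)) : Prop :=
  [/\ y 0 = y0,
      y t @[t --> 0^'+] --> y0 &
      forall t : R, 0 < t ->
        derivable y t 1 /\ derive1 y t + A t *m y t = b t].

(* For 0 < T only, so that the junk value at T = -oo is irrelevant. *)
Definition upper_endpoint (R : realType) (T : \bar R) : set_system R :=
  if T is r%:E then r^'- else +oo.

(* I = \int_0^T F, improper at both ends (F need not be absolutely
   integrable near 0 or near T); entrywise for matrix-valued F. *)
Definition improper_integral (R : realType) (n m : nat) (T : \bar R)
    (F : R -> 'M[R]_(n, m)) (I : 'M[R]_(n, m)) : Prop :=
  (\matrix_(i < n, j < m)
     \int[lebesgue_measure]_(s in `[p.1, p.2]) F s i j)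
    @[p --> filter_prod (0 : R)^'+ (upper_endpoint T)] --> I.

(* u = 0 from T on.  The second clause is void for finite T.  For T = +oo the
   first one is void, and "u = 0 at infinity" is read relative to the
   fundamental matrix G, i.e. G^-1 u --> 0.  Plain u(t) --> 0 would not match
   the integral condition: for n = 1, A = 1, l = 0 one has u(t) = e^-t u_0 --> 0
   but \int_0^oo G^-1 l = 0. *)
Definition vanishes_from (R : realType) (n : nat) (G : R -> 'M[R]_n)
    (T : \bar R) (u : R -> 'cV[R]_n) : Prop :=
  (forall t : R, (T <= t%:E)%E -> u t = 0) /\
  (T = +oo%E -> invmx (G t) *m u t @[t --> +oo] --> (0 : 'cV[R]_n)).

(* Main.v *)
Require Import Defs.
From HB Require Import structures.
From mathcomp Require Import all_boot all_order all_algebra.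
From mathcomp Require Import all_classical all_reals all_analysis.
From mathcomp Require Import ring lra.

Set Implicit Arguments.
Unset Strict Implicit.
Unset Printing Implicit Defensive.

Import Order.TTheory GRing.Theory Num.Theory.
Import numFieldNormedType.Exports.

Local Open Scope classical_set_scope.
Local Open Scope ring_scope.

(** Two solutions of one linear system with the same initial value coincide, so
    [u u0 t = U t *m u0] for [t > 0], where [U] has the solutions started at the
    basis vectors as columns; [U' + A U = - l] and [U 0 = 1].  Variation of
    constants passes to [Phi = G^-1 U], for which the equation is just
    [Phi' = - G^-1 l] with [Phi (0+) = 1].  Integrating,
    [\int_0^q G^-1 l = 1 - Phi q], so the integral up to [T] equals [1] exactly
    when [Phi] tends to [0] at [T] ([improper_integral_cvg]).

    For [T = +oo] this limit is the definition of vanishing at infinity.  For a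
    finite [T], [Phi] is continuous at [T], so the limit says [U T = 0].  If
    moreover [l = 0] beyond [T], then [Phi] is constant there and [U] remains
    zero; conversely, if [U = 0] from [T] on, the equation itself reads [l = 0]
    beyond [T].

    The argument needs [G t] invertible for [t > 0].  Since [A] may be singular
    at [0], a Gronwall estimate is only available away from [0], where it gives
    uniqueness backwards in time: if [G t *m v = 0], then [G *m v] vanishes on
    [(0, t]] ([linear_ode_eq0_before]), whereas it tends to [v] at [0].  Once [G]
    is known to be invertible, uniqueness for the initial value problem follows
    from variation of constants. *)

(** * Limits and derivatives of matrix-valued functions *)

Lemma cvg_mxP (X : Type) (T : topologicalType) (m n : nat)
    (F : set_system X) {FF : Filter F} (f : X -> 'M[T]_(m, n))
    (L : 'M[T]_(m, n)) :
  (f x @[x --> F] --> L) <-> (forall i j, f x i j @[x --> F] --> L i j).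
Proof.
split=> [fL i j V LV|fL V [P LP PV]].
  suff : nbhs L [set M | V (M i j)] by exact: fL.
  exists (fun i' j' => [set y | (i', j') = (i, j) -> V y]) =>
    [i' j'|M]; last first.
    by move=> /(_ i j) /=; exact.
  have [[-> ->]|ij] := pselect ((i', j') = (i, j)).
    by apply: filterS LV => y Vy _.
  by apply: filterS filterT => y _ /ij.
have FP : F [set x | forall ij : 'I_m * 'I_n, P ij.1 ij.2 (f x ij.1 ij.2)].
  by apply: filter_forall => -[i j]; exact: fL (LP i j).
suff : F [set x | V (f x)] by [].
by apply: filterS FP => x Px; apply: PV => i j; exact: (Px (i, j)).
Qed.

Lemma cvg_mulmx (R : numFieldType) (X : Type) (F : set_system X)
    {FF : Filter F} (m n p : nat) (f : X -> 'M[R]_(m, n))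
    (g : X -> 'M[R]_(n, p)) (a : 'M[R]_(m, n)) (b : 'M[R]_(n, p)) :
  f x @[x --> F] --> a -> g x @[x --> F] --> b ->
  f x *m g x @[x --> F] --> a *m b.
Proof.
move=> /cvg_mxP fa /cvg_mxP gb; apply/cvg_mxP => i j.
rewrite mxE; under eq_fun do rewrite mxE.
apply: cvg_big => [|k _]; first exact: add_continuous.
by apply: cvgM; [exact: fa|exact: gb].
Qed.

Lemma cvg_det (R : numFieldType) (X : Type) (F : set_system X)
    {FF : Filter F} (n : nat) (f : X -> 'M[R]_n) (a : 'M[R]_n) :
  f x @[x --> F] --> a -> \det (f x) @[x --> F] --> \det a.
Proof.
move=> /cvg_mxP fa; apply: cvg_big => [|s _]; first exact: add_continuous.
apply: cvgMl_tmp; apply: cvg_big => [|i _]; first exact: mul_continuous.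
exact: fa.
Qed.

(** Cramer: near an invertible limit, the entries of the inverse are quotients of
    determinants. *)
Lemma cvg_invmx (R : numFieldType) (X : Type) (F : set_system X)
    {FF : Filter F} (n : nat) (f : X -> 'M[R]_n) (a : 'M[R]_n) :
  f x @[x --> F] --> a -> a \in unitmx ->
  invmx (f x) @[x --> F] --> invmx a.
Proof.
move=> fa ua.
have da : \det a != 0 by rewrite -unitfE -unitmxE.
have dfa : \det (f x) @[x --> F] --> \det a by exact: cvg_det.
have fE : \forall x \near F,
    (\det (f x))^-1 *: \adj (f x) = invmx (f x).
  apply: filterS (cvgr_neq0 _ dfa da) => x dx.
  by rewrite /invmx unitmxE unitfE dx.
apply: cvg_trans (near_eq_cvg fE) _.
rewrite /invmx ua; apply/cvg_mxP => i j.
rewrite !mxE; under eq_fun do rewrite !mxE.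
apply: cvgM; first exact: cvgV.
apply: cvgMl_tmp; apply: cvg_det; apply/cvg_mxP => k l.
rewrite !mxE; under eq_fun do rewrite !mxE.
by move/cvg_mxP : fa; exact.
Qed.

Lemma is_derive_mxP (R : realFieldType) (V : normedModType R) (m n : nat)
    (M : V -> 'M[R]_(m, n)) (t v : V) (D : 'M[R]_(m, n)) :
  is_derive t v M D <->
  (forall i j, is_derive t v (fun x => M x i j) (D i j)).
Proof.
split=> [[dM <-] i j|dM].
  apply: DeriveDef; first by move/derivable_mxP : dM; exact.
  by rewrite derive_mx// mxE.
have dM' : derivable M t v by apply/derivable_mxP => i j; case: (dM i j).
apply: DeriveDef => //; rewrite derive_mx//; apply/matrixP => i j.
by rewrite mxE; case: (dM i j).
Qed.

Lemma is_derive_mulmx (R : realFieldType) (V : normedModType R) (m n p : nat)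
    (M : V -> 'M[R]_(m, n)) (N : V -> 'M[R]_(n, p)) (t v : V) M' N' :
  is_derive t v M M' -> is_derive t v N N' ->
  is_derive t v (fun x => M x *m N x) (M' *m N t + M t *m N').
Proof.
move=> /is_derive_mxP dM /is_derive_mxP dN; apply/is_derive_mxP => i j.
have -> : (fun x => (M x *m N x) i j) =
    \sum_(k < n) ((fun x => M x i k) * (fun x => N x k j)).
  by apply/funext => x; rewrite mxE fct_sumE.
apply: (is_derive_eq (is_derive_sum (fun k => is_deriveM (dM i k) (dN k j)))).
rewrite !mxE -big_split/=; apply: eq_bigr => k _.
by rewrite addrC; congr (_ + _); exact: mulrC.
Qed.

Lemma is_derive_continuous (R : realFieldType) (W : normedModType R)
    (f : R -> W) (t : R) (D : W) :
  is_derive t 1 f D -> f x @[x --> t] --> f t.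
Proof.
by case=> df _; apply: differentiable_continuous; apply/derivable1_diffP.
Qed.

(** The difference quotient of [M^-1] is [- M(t + h)^-1 Q(h) M(t)^-1], with [Q(h)]
    the one of [M]; continuity of the inverse then suffices, without
    differentiating determinants. *)
Lemma is_derive_invmx (R : realFieldType) (n : nat) (M : R -> 'M[R]_n)
    (t : R) (D : 'M[R]_n) :
  is_derive t 1 M D -> M t \in unitmx ->
  is_derive t 1 (fun x => invmx (M x)) (- (invmx (M t) *m D *m invmx (M t))).
Proof.
move=> dM uM.
have cM := is_derive_continuous dM.
have cMh : M (h *: 1 + t) @[h --> 0^'] --> M t.
  apply: (cvg_comp _ _ _ cM); apply: cvg_within_filter.
  have : (fun h : R => h *: 1 + t) h @[h --> 0] --> (0 : R) *: 1 + t.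
    by apply: cvgD; [apply: cvgZr_tmp; exact: cvg_id|exact: cvg_cst].
  by rewrite scale0r add0r.
have uMh : \forall h \near 0^', M (h *: 1 + t) \in unitmx.
  have dM0 : \det (M t) != 0 by rewrite -unitfE -unitmxE.
  apply: filterS (cvgr_neq0 _ (cvg_det cMh) dM0) => h.
  by rewrite -unitfE -unitmxE.
have dq : h^-1 *: (invmx (M (h *: 1 + t)) - invmx (M t)) @[h --> 0^'] -->
    - (invmx (M t) *m D *m invmx (M t)).
  have qE : \forall h \near 0^',
      - (invmx (M (h *: 1 + t)) *m (h^-1 *: (M (h *: 1 + t) - M t))
         *m invmx (M t)) =
      h^-1 *: (invmx (M (h *: 1 + t)) - invmx (M t)).
    apply: filterS uMh => h uh.
    rewrite -scalemxAr -scalemxAl -scalerN mulmxBr mulVmx// mulmxBl mul1mx.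
    by rewrite -mulmxA mulmxV// mulmx1 opprB.
  apply: cvg_trans (near_eq_cvg qE) _; apply: cvgN.
  apply: cvg_mulmx; last exact: cvg_cst.
  apply: cvg_mulmx; first exact: cvg_invmx.
  by have [dM' <-] := dM; exact: dM'.
by apply: DeriveDef; [exact: cvgP dq|exact: cvg_lim dq].
Qed.

Lemma matrix_FTC2 (R : realType) (m n : nat) (F Phi : R -> 'M[R]_(m, n))
    (p q : R) :
  p < q ->
  (forall t, t \in `[p, q] -> is_derive t 1 Phi (F t)) ->
  (forall t, t \in `[p, q] -> continuous_at t F) ->
  \matrix_(i < m, j < n) \int[lebesgue_measure]_(s in `[p, q]) F s i j =
  Phi q - Phi p.
Proof.
move=> pq dPhi cF; apply/matrixP => i j; rewrite !mxE.
have dPhiij t : t \in `[p, q] -> is_derive t 1 (fun s => Phi s i j) (F t i j).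
  by move=> /dPhi/is_derive_mxP.
rewrite /Rintegral (@continuous_FTC2 _ _ (fun s => Phi s i j))//.
- apply: continuous_in_subspaceT => t /set_mem/= /cF cFt.
  by move: cFt; rewrite /continuous_at => /cvg_mxP; exact.
- have pc : p \in `[p, q] by rewrite in_itv/= lexx ltW.
  have qc : q \in `[p, q] by rewrite in_itv/= lexx ltW.
  split.
  + by move=> t /(subset_itv_oo_cc)/dPhiij[].
  + by apply: cvg_at_right_filter; exact: is_derive_continuous (dPhiij _ pc).
  + by apply: cvg_at_left_filter; exact: is_derive_continuous (dPhiij _ qc).
- by move=> t /(subset_itv_oo_cc)/dPhiij[_ <-]; rewrite derive1E.
Qed.

Lemma is_derive_0_matrix_cst (R : realType) (m n : nat)
    (F Phi : R -> 'M[R]_(m, n)) (p q : R) :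
  p <= q ->
  (forall t, t \in `[p, q] -> is_derive t 1 Phi (F t)) ->
  (forall t, t \in `]p, q[ -> F t = 0) -> Phi p = Phi q.
Proof.
rewrite le_eqVlt => /predU1P[-> //|pq] dPhi F0; apply/matrixP => i j.
have dPhiij t : t \in `[p, q] -> is_derive t 1 (fun s => Phi s i j) (F t i j).
  by move=> /dPhi/is_derive_mxP.
have cPhi : {within `[p, q], continuous (fun s => Phi s i j)}.
  apply: continuous_in_subspaceT => t /set_mem/= /dPhiij.
  exact: is_derive_continuous.
have [c cpq] := MVT pq (fun t tpq => dPhiij t (subset_itv_oo_cc tpq)) cPhi.
by rewrite F0// mxE mul0r => /eqP; rewrite subr_eq0 => /eqP.
Qed.

(** * Linear initial value problems *)

Lemma linear_ivp_is_derive (R : realType) (n m : nat) (A : R -> 'M[R]_n)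
    (b y : R -> 'M[R]_(n, m)) y0 (t : R) :
  linear_ivp A b y0 y -> 0 < t -> is_derive t 1 y (b t - A t *m y t).
Proof.
case=> _ _ dy t0; have [dyt <-] := dy _ t0.
by apply: DeriveDef => //; rewrite addrK derive1E.
Qed.

Lemma linear_ivpB (R : realType) (n m : nat) (A : R -> 'M[R]_n)
    (b c y z : R -> 'M[R]_(n, m)) y0 z0 :
  linear_ivp A b y0 y -> linear_ivp A c z0 z ->
  linear_ivp A (fun t => b t - c t) (y0 - z0) (fun t => y t - z t).
Proof.
move=> hy hz; have [y0E cy _] := hy; have [z0E cz _] := hz.
split=> [||t t0]; [by rewrite y0E z0E|exact: cvgB|].
have [? dE] := is_deriveB (linear_ivp_is_derive hy t0)
  (linear_ivp_is_derive hz t0).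
split=> //; rewrite derive1E dE mulmxBr.
by rewrite opprD [X in X + _]addrACA -opprD subrK.
Qed.

Lemma linear_ivp_mulmxr (R : realType) (n m k : nat) (A : R -> 'M[R]_n)
    (b y : R -> 'M[R]_(n, m)) y0 (c : 'M[R]_(m, k)) :
  linear_ivp A b y0 y ->
  linear_ivp A (fun t => b t *m c) (y0 *m c) (fun t => y t *m c).
Proof.
move=> hy; have [y0E cy _] := hy.
split=> [||t t0]; first by rewrite y0E.
  by apply: cvg_mulmx => //; exact: cvg_cst.
have [? dE] := is_derive_mulmx (linear_ivp_is_derive hy t0)
  (is_derive_cst c t (1 : R)).
by split=> //; rewrite derive1E dE mulmx0 addr0 mulmxBl mulmxA subrK.
Qed.

(** The source is linear in the initial value, so the solutions started at the
    basis vectors assemble into one matrix solution, which then represents the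
    whole family [u] even though [u u0] is not assumed linear in [u0]. *)
Lemma linear_ivp_columns (R : realType) (n : nat) (A l : R -> 'M[R]_n)
    (u : 'cV[R]_n -> R -> 'cV[R]_n) :
  (forall u0, linear_ivp A (fun t => - (l t *m u0)) u0 (u u0)) ->
  linear_ivp A (fun t => - l t) 1%:M
    (fun t => \matrix_(i, j) u (delta_mx j 0) t i 0).
Proof.
move=> hu; pose U t : 'M[R]_n := \matrix_(i, j) u (delta_mx j 0) t i 0.
have colU t j : col j (U t) = u (delta_mx j 0) t.
  by apply/colP => i; rewrite !mxE.
rewrite -/U; split.
- apply/matrixP => i j; rewrite mxE; have [-> _ _] := hu (delta_mx j 0).
  by rewrite !mxE eqxx andbT.
- apply/cvg_mxP => i j; have [_ /cvg_mxP/(_ i 0) + _] := hu (delta_mx j 0).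
  under [X in _ -> X @ _ --> _]eq_fun do rewrite mxE.
  by rewrite !mxE eqxx andbT.
- move=> t t0.
  have dU : is_derive t 1 U (- l t - A t *m U t).
    apply/is_derive_mxP => i j.
    have /is_derive_mxP/(_ i 0) := linear_ivp_is_derive (hu (delta_mx j 0)) t0.
    rewrite -colU colE mulmxA -!colE !mxE.
    by congr is_derive; apply/funext => x; rewrite mxE.
  have [? dE] := dU; split => //.
  by rewrite derive1E dE subrK.
Qed.

(** * Backward uniqueness *)

(** Bound each product by [(x ^+ 2 + y ^+ 2) / 2]; every square then occurs
    [2 n] times. *)
Lemma quadratic_form_ub (R : realFieldType) (n : nat) (B : 'M[R]_n)
    (w : 'I_n -> R) (K : R) :
  (forall i j, `|B i j| <= K) ->
  \sum_i w i * (\sum_j B i j * w j) <= K * n%:R * \sum_i w i ^+ 2.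
Proof.
move=> BK.
have -> : K * n%:R * \sum_i w i ^+ 2 =
    \sum_i \sum_j K / 2 * (w i ^+ 2 + w j ^+ 2).
  under [RHS]eq_bigr do rewrite -mulr_sumr big_split/= sumr_const card_ord.
  rewrite -mulr_sumr big_split/= sumr_const card_ord sumrMnl.
  by rewrite -[(\sum_i _) *+ n]mulr_natr; field.
apply: ler_sum => i _; rewrite mulr_sumr; apply: ler_sum => j _.
apply: (le_trans (ler_norm _)).
rewrite mulrCA !normrM.
apply: (@le_trans _ _ (K * (`|w i| * `|w j|))).
  by rewrite ler_wpM2r// mulr_ge0.
have K0 : 0 <= K := le_trans (normr_ge0 _) (BK i j).
rewrite -mulrA ler_wpM2l// -(real_normK (num_real (w i))).
rewrite -(real_normK (num_real (w j))).
have := sqr_ge0 (`|w i| - `|w j|); nra.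
Qed.

(** Backward Gronwall: let [f] be the sum of squares of a column of [w].  As [A]
    is bounded on the compact interval from [s] to [t1], [f' >= - c f] there for
    some constant [c], so that [expR (c x) * f x] is nondecreasing; it is
    nonnegative and vanishes at [t1]. *)
Lemma linear_ode_eq0_before (R : realType) (n m : nat) (A : R -> 'M[R]_n)
    (w : R -> 'M[R]_(n, m)) (t1 : R) :
  (forall t : R, 0 < t -> continuous_at t A) ->
  (forall t : R, 0 < t -> is_derive t 1 w (- (A t *m w t))) ->
  w t1 = 0 -> forall s : R, 0 < s -> s <= t1 -> w s = 0.
Proof.
move=> cA dw w0 s s0 st1; apply/matrixP => i0 j; rewrite [RHS]mxE.
have [K _ AK] : exists2 K : R, 0 <= K &
    forall x : R, x \in `[s, t1] -> forall i j, `|A x i j| <= K.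
  have cnA : {within `[s, t1], continuous (fun x => `|A x|)}.
    apply: continuous_in_subspaceT => x; rewrite inE/= in_itv/= => /andP[sx _].
    by apply: cvg_norm; apply: cA; exact: lt_le_trans sx.
  have [c _ Ac] := EVT_max st1 cnA.
  exists `|A c| => // x /Ac Axc i k; apply: le_trans Axc.
  rewrite [leRHS]/Num.Def.normr/= mx_normrE.
  exact: (le_bigmax _ (fun ij : 'I_n * 'I_n => `|A x ij.1 ij.2|) (i, k)).
pose f x : R := \sum_i w x i j ^+ 2.
pose c : R := 2 * (K * n%:R).
have df (x : R) : 0 < x ->
    is_derive x 1 f (- 2 * \sum_i w x i j * (\sum_k A x i k * w x k j)).
  move=> x0.
  have dwi i : is_derive x 1 (fun y => w y i j) (- (\sum_k A x i k * w x k j)).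
    by have /is_derive_mxP/(_ i j) := dw _ x0; rewrite !mxE.
  have -> : f = \sum_(i < n) ((fun y => w y i j) ^+ 2).
    by apply/funext => y; rewrite fct_sumE.
  apply: (is_derive_eq (is_derive_sum (fun i => is_deriveX 2 (dwi i)))).
  rewrite mulr_sumr; apply: eq_bigr => i _.
  by rewrite -[LHS]/(_ * _) expr1; ring.
pose g := f * (fun x => expR (c * x)).
have dg (x : R) : 0 < x -> is_derive x 1 g
    (expR (c * x) *
     (c * f x - 2 * \sum_i w x i j * (\sum_k A x i k * w x k j))).
  move=> x0.
  have de : is_derive x 1 (fun y => expR (c * y)) (expR (c * x) * c).
    apply: is_derive1_comp.
    apply: (is_derive_eq (is_deriveZ c (is_derive_id x (1 : R)))).
    by rewrite [LHS]mulr1.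
  apply: (is_derive_eq (is_deriveM (df _ x0) de)).
  by rewrite -![_ *: _]/(_ * _); ring.
have gst : g s <= g t1.
  apply: (@ger0_derive1_ndecr _ g s t1) => // [x|x|].
  - rewrite in_itv/= => /andP[sx _].
    by have [] := dg _ (lt_trans s0 sx).
  - rewrite in_itv/= => /andP[sx xt].
    rewrite derive1E; have [_ ->] := dg _ (lt_trans s0 sx).
    rewrite mulr_ge0 ?expR_ge0// subr_ge0 -mulrA ler_wpM2l//.
    apply: quadratic_form_ub => i k; apply: AK.
    by rewrite in_itv/= !ltW.
  - apply: continuous_in_subspaceT => x; rewrite inE/= in_itv/= => /andP[sx _].
    exact: is_derive_continuous (dg _ (lt_le_trans s0 sx)).
have gt10 : g t1 = 0.
  by rewrite /g/= fctE /f w0 big1 ?mul0r// => i _; rewrite mxE expr0n.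
have fs0 : f s <= 0.
  by rewrite -(pmulr_lle0 _ (expR_gt0 (c * s))) -gt10; exact: gst.
have : w s i0 j ^+ 2 <= 0.
  apply: le_trans fs0; rewrite /f (bigD1 i0)//= lerDl sumr_ge0// => i _.
  exact: sqr_ge0.
by move=> w2; apply/eqP; rewrite -sqrf_eq0 eq_le sqr_ge0 andbT.
Qed.

(** * The fundamental matrix and variation of constants *)

Section fundamental_matrix.
Context (R : realType) (n : nat) (A G : R -> 'M[R]_n)
  (cA : forall t : R, 0 < t -> continuous_at t A)
  (hG : linear_ivp A (fun=> 0) 1%:M G).

(** The columns of [K^T] span the kernel of [G t].  Since [G *m K^T] solves the
    homogeneous system and vanishes at [t], it vanishes on [(0, t]], while its
    limit at [0] is [K^T]. *)
Lemma fundamental_matrix_unit (t : R) : 0 < t -> G t \in unitmx.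
Proof.
move=> t0; rewrite -unitmx_tr -row_free_unit -kermx_eq0.
set K := kermx (G t)^T.
have hGK := linear_ivp_mulmxr K^T hG.
have GtK : G t *m K^T = 0 by rewrite -[LHS]trmxK trmx_mul trmxK mulmx_ker trmx0.
have GK0 : forall s : R, 0 < s -> s <= t -> G s *m K^T = 0.
  apply: (linear_ode_eq0_before cA _ GtK) => s s0.
  by have := linear_ivp_is_derive hGK s0; rewrite /= mul0mx sub0r.
have [_ cGK _] := hGK.
have : (1%:M *m K^T : 'M[R]_n) = 0.
  apply: (cvg_unique _ cGK) => //.
  apply: cvg_near_cst; near=> s; apply: GK0; near: s.
    exact: nbhs_right_gt.
  exact: nbhs_right_le.
by rewrite mul1mx => /(congr1 trmx); rewrite trmxK trmx0 => ->.
Unshelve. all: by end_near. Qed.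

(** [(G^-1)' = G^-1 A] cancels the term [- A y] of [y']. *)
Lemma is_derive_variation_of_constants (m : nat) (b y : R -> 'M[R]_(n, m))
    y0 (t : R) :
  linear_ivp A b y0 y -> 0 < t ->
  is_derive t 1 (fun s => invmx (G s) *m y s) (invmx (G t) *m b t).
Proof.
move=> hy t0; have uG := fundamental_matrix_unit t0.
have dG := linear_ivp_is_derive hG t0.
apply: (is_derive_eq (is_derive_mulmx (is_derive_invmx dG uG)
  (linear_ivp_is_derive hy t0))).
rewrite /= sub0r mulmxN !mulNmx opprK mulmxA mulmxK// mulmxBr mulmxA.
by rewrite addrC subrK.
Qed.

Lemma cvg_invmx_fundamental_matrix (m : nat) (b y : R -> 'M[R]_(n, m)) y0 :
  linear_ivp A b y0 y -> invmx (G t) *m y t @[t --> 0^'+] --> y0.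
Proof.
case=> _ cy _; have [_ cG _] := hG.
rewrite -[X in _ --> X]mul1mx -invmx1.
by apply: cvg_mulmx => //; apply: cvg_invmx => //; exact: unitmx1.
Qed.

Lemma linear_ivp_unique (m : nat) (b y z : R -> 'M[R]_(n, m)) y0 (t : R) :
  linear_ivp A b y0 y -> linear_ivp A b y0 z -> 0 < t -> y t = z t.
Proof.
move=> hy hz t0; have hB := linear_ivpB hy hz.
pose Phi s := invmx (G s) *m (y s - z s).
have Phi_cst (s : R) : 0 < s -> s <= t -> Phi s = Phi t.
  move=> s0 st; apply: (is_derive_0_matrix_cst st) => [x|x _].
    rewrite in_itv/= => /andP[sx _].
    exact: (is_derive_variation_of_constants hB (lt_le_trans s0 sx)).
  by rewrite /= subrr mulmx0.
have Phit : Phi t = y0 - y0.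
  apply/esym/(cvg_unique _ (cvg_invmx_fundamental_matrix hB)) => //.
  apply: cvg_near_cst; near=> s; apply: Phi_cst; near: s.
    exact: nbhs_right_gt.
  exact: nbhs_right_le.
apply/eqP; rewrite -subr_eq0.
rewrite -[_ - _](mulKVmx (fundamental_matrix_unit t0)) -/(Phi t).
by rewrite Phit subrr mulmx0.
Unshelve. all: by end_near. Qed.

Lemma upper_endpoint_proper (T : \bar R) : ProperFilter (upper_endpoint T).
Proof. by case: T => [r||] /=; exact: _. Qed.

(** With [Phi = G^-1 y], the integral over [[p, q]] is [Phi q - Phi p], and
    [Phi p] tends to [y0] at [0]; so the double limit in [(p, q)] exists exactly
    when the limit in [q] alone does. *)
Lemma improper_integral_cvg (T : \bar R) (m : nat)
    (b y : R -> 'M[R]_(n, m)) y0 (I : 'M[R]_(n, m)) :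
  (0 < T)%E -> (forall t : R, 0 < t -> continuous_at t b) ->
  linear_ivp A b y0 y ->
  improper_integral T (fun s => invmx (G s) *m b s) I <->
  invmx (G q) *m y q @[q --> upper_endpoint T] --> y0 + I.
Proof.
move=> T0 cb hy; have FT := upper_endpoint_proper T.
pose Phi s := invmx (G s) *m y s.
have Phi0 := cvg_invmx_fundamental_matrix hy.
have intE : \forall p \near filter_prod (0 : R)^'+ (upper_endpoint T),
    Phi p.2 - Phi p.1 = \matrix_(i < n, j < m)
     \int[lebesgue_measure]_(s in `[p.1, p.2]) (invmx (G s) *m b s) i j.
  (* eventually p < c < q, so that the interval is nondegenerate *)
  have [c c0 cT] : exists2 c, 0 < c & \forall q \near upper_endpoint T, c < q.
    case: T T0 {FT} => [r|_|//]/=.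
      rewrite lte_fin => r0; exists (r / 2); first by rewrite divr_gt0.
      by apply: nbhs_left_gt; rewrite ltr_pdivrMr// mulr2n mulrDr mulr1 ltrDl.
    by exists 1 => //; exact: nbhs_pinfty_gt.
  exists ([set p | 0 < p /\ p < c], [set q | c < q]) => /=.
    by split => //; near=> p; split; near: p;
      [exact: nbhs_right_gt|exact: nbhs_right_lt].
  move=> [p q] /= [[p0 pc] cq]; apply/esym/matrix_FTC2.
  - exact: lt_trans cq.
  - move=> t; rewrite in_itv/= => /andP[pt _].
    exact: (is_derive_variation_of_constants hy (lt_le_trans p0 pt)).
  - move=> t; rewrite in_itv/= => /andP[pt _].
    have t0 := lt_le_trans p0 pt.
    apply: cvg_mulmx; last exact: cb.
    apply: cvg_invmx; last exact: fundamental_matrix_unit.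
    exact: is_derive_continuous (linear_ivp_is_derive hG t0).
have Phi1 : Phi p.1 @[p --> filter_prod (0 : R)^'+ (upper_endpoint T)] --> y0.
  exact: cvg_comp cvg_fst Phi0.
split=> [hI|hPhi].
- have : Phi p.2 @[p --> filter_prod (0 : R)^'+ (upper_endpoint T)] --> y0 + I.
    have Phi21 : Phi p.2 - Phi p.1 @[p --> filter_prod (0 : R)^'+
        (upper_endpoint T)] --> I.
      by apply: cvg_trans hI; apply: near_eq_cvg; apply: filterS intE => p ->.
    rewrite (_ : (fun p => Phi p.2) =
      (fun p : R * R => Phi p.1 + (Phi p.2 - Phi p.1))).
      exact: cvgD.
    by apply/funext => p; rewrite subrKC.
  (* a set of pairs that only constrains q: choose any p in the 0^'+ factor *)
  move=> Phi2 V /Phi2[[P Q] /= [P0 QT] PQV].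
  have [p Pp] := filter_ex P0.
  suff : upper_endpoint T [set q | V (Phi q)] by [].
  by apply: filterS QT => q Qq; exact: (PQV (p, q)).
- apply: cvg_trans (near_eq_cvg intE) _.
  rewrite -[I](addKr y0) addrC; apply: cvgB => //.
  exact: cvg_comp cvg_snd hPhi.
Unshelve. all: by end_near. Qed.

End fundamental_matrix.

(** * Vanishing from the time T on *)

Theorem proposition1 (R : realType) (T : \bar R) (n : nat)
    (A G l : R -> 'M[R]_n) (u : 'cV[R]_n -> R -> 'cV[R]_n)
    (hT : (0 < T)%E)
    (hA : forall t : R, 0 < t -> continuous_at t A)
    (hl : forall t : R, 0 < t -> continuous_at t l)
    (hG : linear_ivp A (fun=> 0) 1%:M G)
    (hu : forall u0 : 'cV[R]_n,
        linear_ivp A (fun t => - (l t *m u0)) u0 (u u0)) :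
  (forall u0 : 'cV[R]_n, vanishes_from G T (u u0)) <->
  (improper_integral T (fun s => invmx (G s) *m l s) 1%:M /\
   forall s : R, (T < s%:E)%E -> l s = 0).
Proof.
have hU := linear_ivp_columns hu; set U := (U in linear_ivp _ _ _ U) in hU.
have uE u0 (t : R) : 0 < t -> u u0 t = U t *m u0.
  move=> t0; have := linear_ivp_mulmxr u0 hU; rewrite mul1mx.
  under [X in linear_ivp _ X]eq_fun do rewrite mulNmx.
  by move=> /(linear_ivp_unique hA hG (hu u0)); exact.
pose Phi t := invmx (G t) *m U t.
have FT := upper_endpoint_proper T.
have intP : improper_integral T (fun s => invmx (G s) *m l s) 1%:M <->
    Phi q @[q --> upper_endpoint T] --> (0 : 'M[R]_n).
  (* - U has the source l, hence the integrand G^-1 l *)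
  have := linear_ivp_mulmxr (- 1%:M) hU.
  rewrite mul1mx.
  under [X in linear_ivp _ X]eq_fun do rewrite mulmxN mulmx1 opprK.
  move=> /(improper_integral_cvg hA hG 1%:M hT hl) ->.
  rewrite addNr.
  under eq_fun do rewrite mulmxN mulmx1 mulmxN.
  by rewrite -[X in _ --> X]oppr0; exact: (cvgNP Phi 0).
rewrite intP {intP}; case: T hT FT => [r r0 FT|_ FT|//]; rewrite /vanishes_from.
- rewrite lte_fin in r0.
  have uU0 : (forall u0, vanishes_from G r%:E (u u0)) <->
      (forall t : R, r <= t -> U t = 0).
    split=> [u0 t rt|U0 u0].
      apply/matrixP => i j; rewrite /U !mxE.
      have [/(_ t) + _] := u0 (delta_mx j 0).
      by rewrite lee_fin => /(_ rt) ->; rewrite mxE.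
    split=> // t; rewrite lee_fin => rt.
    by rewrite uE ?U0 ?mul0mx//; exact: lt_le_trans rt.
  have dPhi (t : R) : 0 < t -> is_derive t 1 Phi (invmx (G t) *m - l t).
    by move=> t0; exact: (is_derive_variation_of_constants hA hG hU).
  have Phir : Phi q @[q --> upper_endpoint r%:E] --> Phi r.
    by apply: cvg_at_left_filter; exact: is_derive_continuous (dPhi _ r0).
  rewrite uU0; split=> [U0|[Phi0 l0] t rt].
  + split; first by move: Phir; rewrite /Phi U0// mulmx0.
    move=> s; rewrite lte_fin => rs.
    have s0 := lt_trans r0 rs.
    have [_] := linear_ivp_is_derive hU s0.
    rewrite U0 ?mulmx0 ?subr0; last exact: ltW.
    (* U vanishes near s, so its equation at s reduces to l s = 0 *)
    have -> : 'D_1 U s = 'D_1 (cst (0 : 'M[R]_n)) s.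
      apply: near_eq_derive.
      by near=> x; apply/U0/ltW; near: x; exact: lt_nbhsr.
    by rewrite derive_cst => /eqP; rewrite eq_sym oppr_eq0 => /eqP.
  + have Phir0 : Phi r = 0 by exact: (cvg_unique _ Phir Phi0).
    have t0 := lt_le_trans r0 rt.
    have Phirt : Phi r = Phi t.
      apply: (is_derive_0_matrix_cst rt) => [x|x]; rewrite in_itv/=.
        by move=> /andP[rx _]; exact: dPhi (lt_le_trans r0 rx).
      by move=> /andP[rx _]; rewrite l0 ?lte_fin// oppr0 mulmx0.
    rewrite -[U t](mulKVmx (fundamental_matrix_unit hA hG t0)) -/(Phi t).
    by rewrite -Phirt Phir0 mulmx0.
- have uPhi u0 : invmx (G t) *m u u0 t @[t --> +oo] --> (0 : 'cV[R]_n) <->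
      Phi t *m u0 @[t --> +oo] --> (0 : 'cV[R]_n).
    have uPhiE : \forall t \near +oo, invmx (G t) *m u u0 t = Phi t *m u0.
      by near=> t; rewrite uE ?mulmxA//; near: t; exact: nbhs_pinfty_gt.
    split=> cv; apply: cvg_trans cv; apply: near_eq_cvg => //.
    by apply: filterS uPhiE => t ->.
  split=> [u0|[Phi0 _] u0].
  + split; last by move=> s; rewrite ltNge leey.
    apply/cvg_mxP => i j.
    have [_ /(_ erefl)/uPhi/cvg_mxP/(_ i 0)] := u0 (delta_mx j 0).
    under [X in X @ _ --> _ -> _]eq_fun do rewrite -colE mxE.
    by rewrite !mxE.
  + split=> [t|_]; first by rewrite leye_eq.
    apply/uPhi; rewrite -(mul0mx _ u0); apply: cvg_mulmx => //.
    exact: cvg_cst.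
Unshelve. all: by end_near. Qed.
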